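(* Let $f,g,k_x,k_y$ satisfy the plant assumption, let $\Phi=\Phi_u+\Phi_y$ and $\mathcal U$ satisfy the cost assumption, and let the plant be monotone with respect to the standard orders ($\mathcal K_U=\mathbb R^m_{\ge0}$, $\mathcal K_X=\mathbb R^n_{\ge0}$, $\mathcal K_Y=\mathbb R^p_{\ge0}$), all as described in the context. Let $k_y(u)=Su$ be linear (with $S\in\mathbb R^{p\times m}$), and let $\Phi_u(u)=\beta_u u^\top u$, $\Phi_y(y)=\beta_y y^\top y$ for some $\beta_u,\beta_y>0$. Assume that $\beta_u>\beta_y\|S\|^2$. Then, for any $\alpha>0$ and any initial condition $x(0)\in\mathbb R^n$, $u(0)\in\mathcal U$, the closed-loop system $$\dot x=f(x,u),\quad y=g(x),\qquad \dot u=\Pi_{\mathcal U}\bigl(u,-\alpha\nabla\Phi_u(u)-\alpha\nabla k_y(u)^\top\nabla\Phi_y(y)\bigr)$$ converges to a solution of the optimization problem $$\min_{u\in\mathcal U,\ y\in\mathbb R^p}\ \Phi_u(u)+\Phi_y(y)\quad\text{subject to}\quad y=k_y(u),$$ i.e. $(u(t),y(t))$ converges as $t\to\infty$ to a minimizer $(u^\star,y^\star)$ of this problem.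
   Context: **Notation.** For differentiable $h:\mathbb R^a\to\mathbb R^b$, $\nabla h(x)\in\mathbb R^{b\times a}$ is the Jacobian; for scalar $h$, $\nabla h(x)$ also denotes the gradient (column vector). $\|S\|$ is the spectral norm of the matrix $S$ (induced by the Euclidean norm). For a closed convex set $C\subseteq\mathbb R^n$, $\mathrm T_C(x)=\operatorname{cl}\bigl(\bigcup_{\delta>0}\frac1\delta(C-x)\bigr)$ is the tangent cone at $x\in C$, and $\Pi_C(x,v)$ is the Euclidean projection of $v$ onto $\mathrm T_C(x)$. All solutions of differential equations are in the Carathéodory sense (absolutely continuous, satisfying the equation for almost all $t$). **Orders.** An orthant $\mathcal K\subset\mathbb R^n$ induces the partial order $x\succcurlyeq_{\mathcal K}y\iff x-y\in\mathcal K$; $\mathbb R^n_{\ge0}$ gives the standard (elementwise) order. **Monotone system.** A system $\dot x=f(x,u)$, $y=g(x)$ is monotone with respect to orthants $\mathcal K_U,\mathcal K_X,\mathcal K_Y$ (in input, state and output space) if (1) for any two measurable, locally bounded inputs with $u(t)\succcurlyeq_{\mathcal K_U}u'(t)$ for almost all $t$ and any initial conditions $x_0\succcurlyeq_{\mathcal K_X}x_0'$, the corresponding solutions (assumed well defined) satisfy $x(t,x_0,u)\succcurlyeq_{\mathcal K_X}x(t,x_0',u')$ for all $t\ge 0$; and (2) $x\succcurlyeq_{\mathcal K_X}x'$ implies $g(x)\succcurlyeq_{\mathcal K_Y}g(x')$. **Plant assumption.** The plant is $\dot x=f(x,u)$, $y=g(x)$ with $f:\mathbb R^n\times\mathbb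 R^m\to\mathbb R^n$ and $g:\mathbb R^n\to\mathbb R^p$ locally Lipschitz. There is a continuous steady-state map $k_x:\mathbb R^m\to\mathbb R^n$: for every constant input $\bar u\in\mathbb R^m$ and every initial condition, the solution of the plant converges to $k_x(\bar u)$ as $t\to\infty$. The steady-state output map is $k_y:=g\circ k_x:\mathbb R^m\to\mathbb R^p$; it is continuously differentiable and $\nabla k_y:\mathbb R^m\to\mathbb R^{p\times m}$ is locally Lipschitz. **Cost assumption.** $\Phi(u,y)=\Phi_u(u)+\Phi_y(y)$ with $\Phi:\mathbb R^m\times\mathbb R^p\to\mathbb R$ continuously differentiable and $\nabla\Phi$ locally Lipschitz. The set $\mathcal U=[u_1^{\min},u_1^{\max}]\times\dots\times[u_m^{\min},u_m^{\max}]\subset\mathbb R^m$ is a compact box. *)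

(* Defs.v *)
(* Vectors of R^n are column vectors 'cV[R]_n.  The library norm `|_| on matrices
   is the max norm; it is only used where the choice of norm is immaterial
   (topology, Lipschitz continuity, boundedness, absolute continuity).
   Euclidean quantities go through [enorm]. *)
From HB Require Import structures.
From mathcomp Require Import all_boot all_order all_algebra.
From mathcomp Require Import all_classical all_reals all_analysis.

Set Implicit Arguments.
Unset Strict Implicit.
Unset Printing Implicit Defensive.

Import Order.TTheory GRing.Theory Num.Theory.
Import numFieldNormedType.Exports.

Local Open Scope classical_set_scope.
Local Open Scope ring_scope.

Section EuclideanGeometry.
Context {R : realType}.

Definition enorm n (v : 'cV[R]_n) : R := Num.sqrt ((v^T *m v) 0 0).

Definition spectral_norm p m (S : 'M[R]_(p, m)) : R :=
  sup [set enorm (S *m v) | v in [set v : 'cV[R]_m | enorm v <= 1]].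

Definition tangent_cone n (C : set 'cV[R]_n) (x : 'cV[R]_n) : set 'cV[R]_n :=
  closure [set v | exists2 d : R, 0 < d & exists2 c, C c & v = d^-1 *: (c - x)].

Definition is_euclidean_projection n (K : set 'cV[R]_n) (v w : 'cV[R]_n) :=
  K w /\ forall z, K z -> enorm (v - w) <= enorm (v - z).

(* For x in a closed convex C the projection onto the tangent cone exists and is
   unique, so the default value 0 is never used. *)
Definition proj_tangent n (C : set 'cV[R]_n) (x v : 'cV[R]_n) : 'cV[R]_n :=
  xget 0 [set w | is_euclidean_projection (tangent_cone C x) v w].

Definition box m (umin umax : 'cV[R]_m) : set 'cV[R]_m :=
  [set u | forall i, umin i 0 <= u i 0 <= umax i 0].

Definition nonneg_orthant n : set 'cV[R]_n := [set x | forall i, 0 <= x i 0].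

Definition cone_ge n (K : set 'cV[R]_n) (x y : 'cV[R]_n) : Prop := K (x - y).

End EuclideanGeometry.

Section Differentiation.
Context {R : realType}.

(* The library's 'J is for row vectors, hence transposed with respect to this
   one. *)
Definition jac a b (h : 'cV[R]_a -> 'cV[R]_b) (x : 'cV[R]_a) : 'M[R]_(b, a) :=
  \matrix_(i, j) ('D_(delta_mx j 0) h x) i 0.

Definition grad a (h : 'cV[R]_a -> R) (x : 'cV[R]_a) : 'cV[R]_a :=
  \col_j 'D_(delta_mx j 0) h x.

Definition locally_lipschitz (V W : normedModType R) (h : V -> W) : Prop :=
  forall x : V, lipschitz_on h (nbhs (x, x)).

End Differentiation.

Section DifferentialEquations.
Context {R : realType}.

Definition absolutely_continuous n (a b : R) (z : R -> 'cV[R]_n) : Prop :=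
  forall e : R, 0 < e -> exists2 d : R, 0 < d &
    forall (k : nat) (I : 'I_k -> R * R),
      (forall i, [/\ a <= (I i).1, (I i).1 <= (I i).2 & (I i).2 <= b]) ->
      trivIset setT (fun i => `](I i).1, (I i).2[%classic) ->
      \sum_(i < k) ((I i).2 - (I i).1) < d ->
      \sum_(i < k) `|z (I i).2 - z (I i).1| < e.

(* Caratheodory solution of z' = F t z on [0, +oo); the values of z at negative
   times are irrelevant. *)
Definition caratheodory_solution n (F : R -> 'cV[R]_n -> 'cV[R]_n)
    (z : R -> 'cV[R]_n) : Prop :=
  (forall T : R, 0 <= T -> absolutely_continuous 0 T z) /\
  {ae (@lebesgue_measure R),
    forall t : R, 0 <= t -> is_derive t (1 : R) z (F t (z t))}.

Definition plant_solution n m (f : 'cV[R]_n -> 'cV[R]_m -> 'cV[R]_n)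
    (u : R -> 'cV[R]_m) (x0 : 'cV[R]_n) (x : R -> 'cV[R]_n) : Prop :=
  x 0 = x0 /\ caratheodory_solution (fun t xi => f xi (u t)) x.

Definition admissible_input m (u : R -> 'cV[R]_m) : Prop :=
  (forall i, measurable_fun (`[0, +oo[%classic : set R) (fun t => u t i 0)) /\
  (forall T : R, [bounded u t | t in `[0, T]%classic]).

(* The first conjunct is the standing proviso that the solutions being compared
   are well defined on [0, +oo); they are then unique on [0, +oo), f being
   locally Lipschitz. *)
Definition monotone_system n m p (f : 'cV[R]_n -> 'cV[R]_m -> 'cV[R]_n)
    (g : 'cV[R]_n -> 'cV[R]_p) (KU : set 'cV[R]_m) (KX : set 'cV[R]_n)
    (KY : set 'cV[R]_p) : Prop :=
  [/\ forall u x0, admissible_input u -> exists x, plant_solution f u x0 x,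
      forall u u' x0 x0' x x',
        admissible_input u -> admissible_input u' ->
        {ae (@lebesgue_measure R),
          forall t : R, 0 <= t -> cone_ge KU (u t) (u' t)} ->
        cone_ge KX x0 x0' ->
        plant_solution f u x0 x -> plant_solution f u' x0' x' ->
        forall t : R, 0 <= t -> cone_ge KX (x t) (x' t) &
      forall x x', cone_ge KX x x' -> cone_ge KY (g x) (g x')].

Definition plant_assumption n m p (f : 'cV[R]_n -> 'cV[R]_m -> 'cV[R]_n)
    (g : 'cV[R]_n -> 'cV[R]_p) (kx : 'cV[R]_m -> 'cV[R]_n) : Prop :=
  [/\ locally_lipschitz (fun z : 'cV[R]_n * 'cV[R]_m => f z.1 z.2),
      locally_lipschitz g,
      continuous kx,
      forall (ubar : 'cV[R]_m) (x0 : 'cV[R]_n),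
        (exists x, plant_solution f (cst ubar) x0 x) /\
        (forall x, plant_solution f (cst ubar) x0 x ->
          x t @[t --> +oo] --> kx ubar) &
      [/\ forall u, differentiable (g \o kx) u,
          continuous (jac (g \o kx)) &
          locally_lipschitz (jac (g \o kx))]].

(* The gradient of Phi is taken jointly in (u, y), stacked in R^(m + p). *)
Definition cost_assumption m p (Phi : 'cV[R]_m -> 'cV[R]_p -> R)
    (Phi_u : 'cV[R]_m -> R) (Phi_y : 'cV[R]_p -> R) : Prop :=
  let Phi_joint := fun w : 'cV[R]_(m + p) => Phi (usubmx w) (dsubmx w) in
  [/\ forall u y, Phi u y = Phi_u u + Phi_y y,
      forall w, differentiable Phi_joint w,
      continuous (grad Phi_joint) &
      locally_lipschitz (grad Phi_joint)].

(* The tangent cone, hence the controller, is only defined on U; a solution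
   therefore has u(t) in U at all times t >= 0. *)
Definition closed_loop_solution n m p (f : 'cV[R]_n -> 'cV[R]_m -> 'cV[R]_n)
    (g : 'cV[R]_n -> 'cV[R]_p) (ky : 'cV[R]_m -> 'cV[R]_p)
    (Phi_u : 'cV[R]_m -> R) (Phi_y : 'cV[R]_p -> R) (U : set 'cV[R]_m)
    (alpha : R) (x0 : 'cV[R]_n) (u0 : 'cV[R]_m)
    (x : R -> 'cV[R]_n) (u : R -> 'cV[R]_m) : Prop :=
  [/\ plant_solution f u x0 x,
      u 0 = u0,
      forall t : R, 0 <= t -> U (u t) &
      caratheodory_solution (fun t v =>
        proj_tangent U v
          (- (alpha *: grad Phi_u v)
           - alpha *: ((jac ky v)^T *m grad Phi_y (g (x t))))) u].

Definition is_minimizer m p (Phi_u : 'cV[R]_m -> R) (Phi_y : 'cV[R]_p -> R)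
    (U : set 'cV[R]_m) (ky : 'cV[R]_m -> 'cV[R]_p)
    (ustar : 'cV[R]_m) (ystar : 'cV[R]_p) : Prop :=
  [/\ U ustar, ystar = ky ustar &
      forall u y, U u -> y = ky u ->
        Phi_u ustar + Phi_y ystar <= Phi_u u + Phi_y y].

End DifferentialEquations.

(* Main.v *)
Require Import Defs.
From HB Require Import structures.
From mathcomp Require Import all_boot all_order all_algebra.
From mathcomp Require Import all_classical all_reals all_analysis.
From mathcomp Require Import measurable_realfun ring lra.

Set Implicit Arguments.
Unset Strict Implicit.
Unset Printing Implicit Defensive.

Import Order.TTheory GRing.Theory Num.Theory.
Import numFieldNormedType.Exports.

Local Open Scope classical_set_scope.
Local Open Scope ring_scope.

(** The closed loop is a negative feedback interconnection of two monotone
    systems, and it converges because the gain around the loop is below one.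

    Let [wlo] and [whi] be the coordinatewise inferior and superior limits of
    the input [u].  From some time on [u] lies between [wlo - e] and [whi + e],
    so by monotonicity the plant state lies between the trajectories driven by
    these two constant inputs, which settle at their steady states; hence the
    output [y] asymptotically lies between [S wlo] and [S whi]
    ([output_eventually_ge], [output_eventually_le]).  Monotonicity also forces
    the entries of [S] to be nonnegative ([steady_state_ge0]), so that [S^T y]
    lies between [S^T S wlo] and [S^T S whi].

    On a box the projection onto the tangent cone acts coordinate by
    coordinate, so each coordinate of the controller is a scalar inequality:
    above any level [M > umin_i] with
    [beta_u * M + beta_y * (S^T S wlo)_i > 0] the input decreases at a uniform
    rate and ends up below [M] ([controller_eventually_le]), and symmetrically
    from below.  Feeding this back gives
    [beta_u * whi_i + beta_y * (S^T S wlo)_i <= 0] unless [whi_i = umin_i], and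
    [0 <= beta_u * wlo_i + beta_y * (S^T S whi)_i] unless [wlo_i = umax_i].
    Subtracting, the nonnegative vector [w = whi - wlo] satisfies
    [beta_u w <= beta_y S^T S w], and pairing with [w] yields
    [beta_u |w|^2 <= beta_y |S w|^2 <= beta_y |S|^2 |w|^2], whence [w = 0]
    ([small_gain]).  So [u] converges, [y] converges to its image by [S], and
    the two displayed inequalities become the first-order optimality conditions
    of the convex program at the limit ([box_quad_minimizer]).

    The analytic core is [absolutely_continuous_drift]: a Caratheodory solution
    whose derivative is below [- k] at almost every time spent above [M] does
    decrease at that rate.  It is proved without Lebesgue integration, by
    induction along the interval. *)

(** * Absolutely continuous functions with a drift *)

Section Drift.
Context {R : realType}.
Local Notation mu := (@lebesgue_measure R).

(** Continuous induction in the form of Cousin's lemma: every point [s] comes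
    with a gauge [d], and [P] only has to be transported across intervals
    around [s] that are finer than the gauge. *)
Lemma interval_induction (P : R -> Prop) (a b : R) : a <= b -> P a ->
  (forall s, a <= s <= b -> exists2 d, 0 < d & forall p q,
     a <= p -> q <= b -> s - d < p <= s -> s <= q < s + d -> P p -> P q) ->
  P b.
Proof.
move=> ab Pa step.
pose A := [set t | a <= t <= b /\ P t].
have Aa : A a by split => //; rewrite lexx ab.
have supA : has_sup A by split; [exists a | exists b => t [/andP[]]//].
have ubA : has_ubound A by case: supA.
have sab : a <= sup A <= b.
  apply/andP; split; first by apply: ub_le_sup.
  by apply: ge_sup; [exists a | move=> t [/andP[]]//].
have [d d0 Hd] := step _ sab.
have [p [/andP[ap pb] Pp] sdp] := sup_adherent d0 supA.
have Ap : A p by split=> //; apply/andP.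
have ps : p <= sup A by exact: ub_le_sup Ap.
pose q := Num.min b (sup A + d / 2).
have [sa sb] := andP sab.
have qb : q <= b by rewrite ge_min lexx.
have sq : sup A <= q by rewrite le_min sb/= lerDl divr_ge0 ?ltW.
have qd : q < sup A + d.
  by rewrite gt_min ltrD2l ltr_pdivrMr// ltr_pMr// ltr1n orbT.
have Pq : P q by apply: (Hd p q) => //; [rewrite sdp | rewrite sq].
have qs : q <= sup A.
  by apply: (ub_le_sup ubA); split => //; rewrite qb (le_trans sa sq).
suff -> : b = q by [].
have /eqP : q = sup A by apply/eqP; rewrite eq_le qs sq.
by rewrite /q; case: leP => // _; rewrite -subr_eq0 addrAC subrr add0r => /eqP; lra.
Qed.

Lemma negligible_open_cover (N : set R) (e : R) : mu.-negligible N -> 0 < e ->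
  exists O, [/\ open O, N `<=` O & (mu O < e%:E)%E].
Proof.
move=> [B [mB muB NB]] e0.
have [|O [oO BO muO]] := lebesgue_regularity_outer mB _ e0.
  by rewrite [X in (X < _)%E]muB ltry.
exists O; split => //; first exact: subset_trans BO.
have mO : measurable O by exact: measurable_realfun.open_measurable.
rewrite -(setDUK BO) (@le_lt_trans _ _ (mu B + mu (O `\` B))%E)//.
  by apply: measureU2 => //; exact: measurableD.
by rewrite [X in (X + _)%E]muB add0e.
Qed.

Lemma total_length_lt (k : nat) (I : 'I_k -> R * R) (O : set R) (d : R) :
  (forall i, (I i).1 <= (I i).2) ->
  (forall i, `](I i).1, (I i).2[%classic `<=` O) ->
  trivIset setT (fun i => `](I i).1, (I i).2[%classic) ->
  open O -> (mu O < d%:E)%E -> \sum_(i < k) ((I i).2 - (I i).1) < d.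
Proof.
move=> I12 IO tI oO; rewrite -lte_fin; apply: le_lt_trans.
pose U := \big[setU/set0]_(i < k) `](I i).1, (I i).2[%classic.
have mU : measurable (U : set R) by exact: bigsetU_measurable.
have -> : (\sum_(i < k) ((I i).2 - (I i).1))%:E = mu U.
  rewrite /U measure_semi_additive_ord//=.
  rewrite -sumEFin; apply: eq_bigr => i _; rewrite lebesgue_measure_itv/= lte_fin.
  have := I12 i; rewrite le_eqVlt => /orP[/eqP->|->]; last by rewrite EFinB.
  by rewrite ltxx subrr.
apply: le_measure; rewrite ?inE//; first exact: measurable_realfun.open_measurable.
rewrite /U; elim/big_ind : _ => // A B AO BO; rewrite subUset; exact: conj.
Qed.

Lemma coord_normr_le n (v : 'cV[R]_n) i : `|v i 0| <= `|v|.
Proof.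
rewrite [leRHS]mx_normrE; apply: (le_bigmax _ (fun ij => `|v ij.1 ij.2|) (i, 0)).
Qed.

Lemma absolutely_continuous_close n (a b e : R) (z : R -> 'cV[R]_n) :
  absolutely_continuous a b z -> 0 < e -> exists2 d, 0 < d &
    forall p q, a <= p -> p <= q -> q <= b -> q - p < d -> `|z q - z p| < e.
Proof.
move=> /[apply] -[d d0 H]; exists d => // p q ap pq qb qpd.
have := H 1%N (fun=> (p, q)); rewrite !big_ord1 /=; apply => //.
by move=> i j _ _ _; rewrite !ord1.
Qed.

(** A derivative at [s] controls increments over intervals that straddle [s],
    which is what a partition tagged at [s] needs. *)
Lemma is_derive_increment n (z : R -> 'cV[R]_n) (s : R) (D : 'cV[R]_n) i (e : R) :
  is_derive s (1 : R) z D -> 0 < e -> exists2 d, 0 < d &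
    forall p q, s - d < p <= s -> s <= q < s + d ->
      z q i 0 - z p i 0 <= (D i 0 + e) * (q - p).
Proof.
move=> zD e0; have /cvg_ex[/= l zl] := ex_derive (is_derive := zD).
have lD : l = D.
  by rewrite -(derive_val (is_derive := zD)) /derive; apply/esym/cvg_lim.
move: zl; rewrite {}lD => zl.
have /= := cvg_comp _ _ zl (@coord_continuous _ _ _ i 0 D).
move=> /cvgrPdist_lt/(_ _ e0)/nbhs_ballP[d /= d0 Hd]; exists d => // p q.
move=> /andP[sp ps] /andP[sq qs].
have right : z q i 0 - z s i 0 <= (D i 0 + e) * (q - s).
  have [->|qNs] := eqVneq q s; first by rewrite !subrr mulr0.
  have qs0 : 0 < q - s by rewrite subr_gt0 lt_neqAle eq_sym qNs.
  have := Hd (q - s); rewrite /ball/= sub0r normrN gtr0_norm// ltrBlDl subr_eq0.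
  move=> /(_ qs qNs); rewrite scaler1 subrK !mxE => H.
  rewrite mulrC -ler_pdivrMl// -lerBlDl; apply/ltW/(le_lt_trans _ H).
  by rewrite distrC ler_norm.
have left : z s i 0 - z p i 0 <= (D i 0 + e) * (s - p).
  have [->|pNs] := eqVneq p s; first by rewrite !subrr mulr0.
  have ps0 : 0 < s - p by rewrite subr_gt0 lt_neqAle pNs.
  have := Hd (p - s); rewrite /ball/= sub0r opprB gtr0_norm//.
  rewrite ltrBlDl -ltrBlDr subr_eq0 => /(_ sp pNs).
  rewrite scaler1 subrK !mxE -(opprB s p) invrN mulNr -mulrN opprB => H.
  rewrite mulrC -ler_pdivrMl// -lerBlDl; apply/ltW/(le_lt_trans _ H).
  by rewrite distrC ler_norm.
lra.
Qed.

(** Fix [e] and cover the null set of bad times by an open set [V] of small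
    measure.  Along the interval [z s] stays below the maximum of [M + e] and a
    line of slope [- (k - e)], up to a correction for finitely many disjoint
    intervals contained in [V]: the increment of [z] over each of them, plus [k]
    times its length to make up for the descent of the line.  Around a time [s]
    in [V] the current interval joins this family; every other time is good, and
    either [z s <= M] and continuity keeps [z] below [M + e], or [M < z s] and
    the derivative makes [z] descend at least as fast as the line.  The total length of the family is
    below the measure of [V], so absolute continuity makes the correction at
    most [2 * e]. *)
Lemma absolutely_continuous_drift n (a b M k : R) (z : R -> 'cV[R]_n) i :
  a <= b -> absolutely_continuous a b z -> 0 < k ->
  {ae mu, forall t, a <= t <= b -> M < z t i 0 ->
     exists2 D, is_derive t (1 : R) z D & D i 0 <= - k} ->
  z b i 0 <= Num.max M (z a i 0 - k * (b - a)).
Proof.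
move=> ab acz k0 aez.
suff H (e : R) : 0 < e -> e <= k ->
    z b i 0 <= Num.max (M + e) (z a i 0 - (k - e) * (b - a)) + e + e.
  apply/ler_addgt0Pr => e e0.
  (* three errors [e'], and a slope off by [e'] over a length [b - a] *)
  pose c := 3 + (b - a); have c3 : 3 <= c by rewrite lerDl subr_ge0.
  have c0 : 0 < c by lra.
  pose e' := Num.min k (e / c).
  have e'0 : 0 < e' by rewrite lt_min k0 divr_gt0.
  have e'k : e' <= k by rewrite ge_min lexx.
  have e'e : e' * c <= e by rewrite -ler_pdivlMr// ge_min lexx orbT.
  have e'3 : e' * 3 <= e' * c by rewrite ler_pM2l.
  apply: le_trans (H _ e'0 e'k) _; rewrite -2!lerBrDr ge_max; apply/andP; split.
    have : M <= Num.max M (z a i 0 - k * (b - a)) by rewrite le_max lexx.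
    lra.
  have : z a i 0 - k * (b - a) <= Num.max M (z a i 0 - k * (b - a)).
    by rewrite le_max lexx orbT.
  move: e'e; rewrite /c; lra.
move=> e0 ek.
have [d d0 Hd] := acz _ e0.
(* a family of total length below [e / k] costs at most [e] in lengths *)
pose d1 := Num.min d (e / k).
have d10 : 0 < d1 by rewrite lt_min d0 divr_gt0.
have [d1d d1e] : d1 <= d /\ d1 <= e / k by split; rewrite ge_min lexx ?orbT.
have [V [oO NO muO]] := negligible_open_cover aez d10.
pose bound (s : R) : R := Num.max (M + e) (z a i 0 - (k - e) * (s - a)).
pose G s := exists l (J : nat -> R * R),
  [/\ forall j, (j < l)%N ->
        [/\ a <= (J j).1, (J j).1 <= (J j).2, (J j).2 <= s &
        `](J j).1, (J j).2[%classic `<=` V],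
      trivIset `I_l (fun j => `](J j).1, (J j).2[%classic) &
      z s i 0 <= bound s +
        \sum_(j < l) (`|z (J j).2 - z (J j).1| + k * ((J j).2 - (J j).1))].
suff [l [J [HJ tJ zb]]] : G b.
  have lJ : \sum_(j < l) ((J j).2 - (J j).1) < d1.
    apply: (total_length_lt _ _ _ oO muO) => [j|j|j j1 _ _ jj1].
    + by have [] := HJ j (ltn_ord j).
    + by have [] := HJ j (ltn_ord j).
    + exact/val_inj/(tJ j j1 (ltn_ord j) (ltn_ord j1)).
  apply: le_trans zb _; rewrite -addrA lerD2l big_split/= -mulr_sumr.
  apply: lerD; last by rewrite mulrC -ler_pdivlMr//; apply/ltW/(lt_le_trans lJ).
  apply/ltW/(Hd l (fun j => J j)); last exact: lt_le_trans lJ _.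
  - by move=> j; have [] := HJ j (ltn_ord j).
  - move=> j j' _ _ jj'; exact/val_inj/(tJ j j' (ltn_ord j) (ltn_ord j')).
apply: (@interval_induction G a b ab).
  exists 0%N, (fun=> (a, a)); split => //.
  by rewrite big_ord0 addr0 /bound subrr mulr0 subr0 le_max lexx orbT.
move=> s sab.
have bound_step p q : p <= q -> bound p - (k - e) * (q - p) <= bound q.
  move=> pq; rewrite lerBlDr ge_max; apply/andP; split.
    have : M + e <= bound q by rewrite le_max lexx.
    have : 0 <= (k - e) * (q - p) by rewrite mulr_ge0 ?subr_ge0.
    lra.
  have : z a i 0 - (k - e) * (q - a) <= bound q by rewrite le_max lexx orbT.
  lra.
have keep p q (l : nat) (J : nat -> R * R) : p <= q ->
    (forall j, (j < l)%N -> [/\ a <= (J j).1, (J j).1 <= (J j).2, (J j).2 <= p &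
        `](J j).1, (J j).2[%classic `<=` V]) ->
    forall j, (j < l)%N -> [/\ a <= (J j).1, (J j).1 <= (J j).2, (J j).2 <= q &
        `](J j).1, (J j).2[%classic `<=` V].
  by move=> pq H j /H[h1 h2 h3 h4]; split => //; apply: le_trans pq.
have [Os|Os] := pselect (V s).
  have /nbhs_ballP[r /= r0 rO] : nbhs s V by apply: open_nbhs_nbhs.
  exists r => // p q ap qb /andP[sp ps] /andP[sq qs] [l [J [HJ tJ zp]]].
  have pq := le_trans ps sq.
  exists l.+1, (fun j => if j == l then (p, q) else J j); split.
  - move=> j; rewrite ltnS leq_eqVlt => /orP[/eqP->|jl].
      rewrite eqxx; split => //= t /=; rewrite in_itv/= => /andP[pt tq].
      apply: rO; rewrite /ball/= ltr_norml; apply/andP; split; lra.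
    by rewrite ltn_eqF//; exact: keep pq HJ _ jl.
  - have disj j (t : R) : (j < l)%N -> `](J j).1, (J j).2[%classic t ->
        `]p, q[%classic t -> False.
      move=> /HJ[_ _ Jp _] /=; rewrite !in_itv/= => /andP[_ h] /andP[h' _].
      by have := lt_trans h' (lt_le_trans h Jp); rewrite ltxx.
    move=> j j' /=; rewrite !ltnS [(j <= l)%N]leq_eqVlt [(j' <= l)%N]leq_eqVlt.
    case: (eqVneq j l) => [->|jl] /=; case: (eqVneq j' l) => [->|j'l] //=.
    + by move=> _ j'l' [t [/= h h']]; case: (disj j' t).
    + by move=> j'l' _ [t [/= h h']]; case: (disj j t).
    + by move=> jl' j'l'; apply: tJ.
  - rewrite big_ord_recr/= eqxx.
    under eq_bigr => j _ do rewrite ltn_eqF//.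
    have h1 := ler_norm ((z q - z p) i 0).
    have h2 := coord_normr_le (z q - z p) i.
    have h3 := bound_step _ _ pq.
    have h4 : (k - e) * (q - p) <= k * (q - p).
      by rewrite ler_wpM2r ?subr_ge0// gerBl ltW.
    move: h1 h2 zp; rewrite !mxE /=; lra.
have [zsM|Mzs] := leP (z s i 0) M.
  have [d2 d20 Hd2] := absolutely_continuous_close acz e0.
  exists (d2 / 2); first by rewrite divr_gt0.
  move=> p q ap qb /andP[sp ps] /andP[sq qs] [l [J [HJ tJ zp]]].
  have pq := le_trans ps sq.
  exists l, J; split => //; first exact: keep pq HJ.
  have [sa sb] := andP sab.
  have zq : z q i 0 <= M + e.
    have h1 : `|z q - z s| < e by apply: Hd2 => //; lra.
    have h2 := coord_normr_le (z q - z s) i.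
    have h3 := ler_norm ((z q - z s) i 0).
    move: h2 h3; rewrite !mxE; lra.
  have : M + e <= bound q by rewrite le_max lexx.
  have : 0 <= \sum_(j < l) (`|z (J j).2 - z (J j).1| + k * ((J j).2 - (J j).1)).
    apply: sumr_ge0 => j _; rewrite addr_ge0// mulr_ge0 ?(ltW k0)// subr_ge0.
    by have [] := HJ j (ltn_ord j).
  lra.
have [D zD Dk] : exists2 D, is_derive s (1 : R) z D & D i 0 <= - k.
  by apply: contrapT => nD; apply: Os; apply: NO => /= /(_ sab Mzs).
have [r r0 Hr] := is_derive_increment i zD e0.
exists r => // p q ap qb sp sq [l [J [HJ tJ zp]]].
have pq : p <= q by case/andP: sp => _ ps; case/andP: sq => /(le_trans ps).
exists l, J; split => //; first exact: keep pq HJ.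
have h1 := Hr p q sp sq.
have h2 := bound_step _ _ pq.
have h3 : (D i 0 + e) * (q - p) <= (- k + e) * (q - p).
  by rewrite ler_wpM2r ?subr_ge0// lerD2r.
lra.
Qed.

(** Translation invariance lets trajectories be restarted at a later time. *)
Lemma lebesgue_measure_shift (T : R) (A : set R) : measurable A ->
  pushforward mu ((fun t : R => t + T) : _ -> measurableTypeR R) A = mu A.
Proof.
have mT : measurable_fun setT
    ((fun t : R => t + T) : measurableTypeR R -> measurableTypeR R).
  exact: measurable_funD.
move=> mA; apply/esym/lebesgue_measure_unique => //= _ [[a b]] _ <-.
rewrite /pushforward.
have -> : (fun t : R => t + T) @^-1` `]a, b] = `](a - T), (b - T)]%classic.
  by apply/seteqP; split => t /=; rewrite !in_itv/= ltrBlDr lerBrDr.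
by rewrite /= !lebesgue_measure_itv/= !lte_fin ltrD2r -!EFinB opprD opprK addrACA addNr
  addr0.
Qed.

Lemma ae_imply (P Q : R -> Prop) : (forall t, P t -> Q t) ->
  {ae mu, forall t, P t} -> {ae mu, forall t, Q t}.
Proof. by move=> PQ; apply: negligibleS => t /= + /PQ. Qed.

Lemma ae_shift (P : R -> Prop) (T : R) :
  {ae mu, forall t, P t} -> {ae mu, forall t, P (t + T)}.
Proof.
move=> [B [mB muB PB]].
have mT : measurable_fun setT
    ((fun t : R => t + T) : measurableTypeR R -> measurableTypeR R).
  exact: measurable_funD.
exists ((fun t => t + T) @^-1` B); split.
- by rewrite -[X in measurable X]setTI; exact: mT.
- by rewrite -[RHS]muB -(lebesgue_measure_shift T mB).
- by move=> t /= /PB.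
Qed.

Lemma absolutely_continuous_shift n (a b T : R) (z : R -> 'cV[R]_n) :
  absolutely_continuous (a + T) (b + T) z ->
  absolutely_continuous a b (fun t => z (t + T)).
Proof.
move=> acz e /acz[d d0 Hd]; exists d => // k I HI tI sI.
apply: (Hd k (fun j => ((I j).1 + T, (I j).2 + T))).
- by move=> j; have [] := HI j; rewrite /= !lerD2r.
- move=> i j _ _ [t [/= hi hj]]; apply: tI => //.
  by exists (t - T); move: hi hj; rewrite /= !in_itv/= !ltrBrDr !ltrBlDr.
- by under eq_bigr do rewrite /= opprD addrACA subrr addr0.
Qed.

Lemma absolutely_continuousS n (a b a' b' : R) (z : R -> 'cV[R]_n) :
  a <= a' -> b' <= b -> absolutely_continuous a b z ->
  absolutely_continuous a' b' z.
Proof.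
move=> aa bb acz e /acz[d d0 Hd]; exists d => // k I HI; apply: Hd => j.
have [h1 h2 h3] := HI j; split => //.
  exact: le_trans aa h1.
exact: le_trans h3 bb.
Qed.

Lemma absolutely_continuousN n (a b : R) (z : R -> 'cV[R]_n) :
  absolutely_continuous a b z -> absolutely_continuous a b (fun t => - z t).
Proof.
move=> acz e /acz[d d0 Hd]; exists d => // k I HI tI sI.
by under eq_bigr do rewrite -opprD normrN; exact: Hd.
Qed.

Lemma is_derive_shift n (z : R -> 'cV[R]_n) (t T : R) D :
  is_derive (t + T) (1 : R) z D -> is_derive t (1 : R) (fun s => z (s + T)) D.
Proof.
have E : (fun h : R =>
      h^-1 *: (((fun s => z (s + T)) \o shift t) (h *: (1 : R)) - z (t + T))) =
  (fun h : R => h^-1 *: ((z \o shift (t + T)) (h *: (1 : R)) - z (t + T))).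
  by apply/funext => h /=; rewrite addrA.
by move=> [dz Dz]; split; [move: dz; rewrite /derivable E | rewrite -Dz /derive E].
Qed.

(** The plant is compared with constant inputs only from the time when the
    bounds on its input hold, so solutions have to be restarted. *)
Lemma caratheodory_shift n (F : R -> 'cV[R]_n -> 'cV[R]_n) z (T : R) : 0 <= T ->
  caratheodory_solution F z ->
  caratheodory_solution (fun t => F (t + T)) (fun t => z (t + T)).
Proof.
move=> T0 [acz aez]; split.
  move=> b b0; apply: absolutely_continuous_shift.
  by apply: absolutely_continuousS (acz (b + T) _); rewrite ?addr_ge0// add0r.
apply: ae_imply (ae_shift T aez) => t H t0.
by apply: is_derive_shift; apply: H; exact: addr_ge0.
Qed.

Lemma caratheodory_continuous n (F : R -> 'cV[R]_n -> 'cV[R]_n) z i :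
  caratheodory_solution F z -> {within `[0, +oo[, continuous (fun t => z t i 0)}.
Proof.
move=> [acz _]; apply/subspace_continuousP => t /=; rewrite in_itv/= andbT => t0.
apply/cvgrPdist_lt => e e0.
have t10 : 0 <= t + 1 by rewrite addr_ge0.
have [d d0 Hd] := absolutely_continuous_close (acz _ t10) e0.
near=> s.
have s0 : 0 <= s.
  suff : `[0, +oo[%classic s by rewrite /= in_itv/= andbT.
  by near: s; exact: withinT.
have std : `|t - s| < d.
  by near: s; apply: cvg_within; apply: (@cvgr_dist_lt _ _ _ (nbhs t)).
have st1 : `|t - s| < 1.
  by near: s; apply: cvg_within; apply: (@cvgr_dist_lt _ _ _ (nbhs t)).
have := coord_normr_le (z t - z s) i; rewrite !mxE => /le_lt_trans; apply.
have [st|ts] := leP s t.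
  by apply: Hd => //; [rewrite lerDl | exact: le_lt_trans (ler_norm _) std].
rewrite distrC; apply: Hd => //; [exact: ltW| |].
  move: st1; rewrite ltr_norml; lra.
move: std; rewrite ltr_norml; lra.
Unshelve. all: by end_near. Qed.

(** The descending line of [absolutely_continuous_drift] crosses the level [M]
    in finite time, and the same bound then keeps the trajectory below [M]. *)
Lemma eventually_le_of_drift n (z : R -> 'cV[R]_n) i (M k T : R) :
  0 <= T -> (forall b, 0 <= b -> absolutely_continuous 0 b z) -> 0 < k ->
  {ae mu, forall t, T <= t -> M < z t i 0 ->
     exists2 D, is_derive t (1 : R) z D & D i 0 <= - k} ->
  \forall t \near +oo, z t i 0 <= M.
Proof.
move=> T0 acz k0 aez; near=> t.
have Tt : T <= t by near: t; apply: nbhs_pinfty_ge; exact: num_real.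
have tk : T + (z T i 0 - M) / k <= t.
  by near: t; apply: nbhs_pinfty_ge; exact: num_real.
have := @absolutely_continuous_drift n T t M k z i Tt _ k0 _.
rewrite max_l; last by rewrite lerBlDr -lerBlDl mulrC -ler_pdivrMr// lerBrDl.
apply.
  by apply: absolutely_continuousS (acz t _); rewrite ?(le_trans T0).
by apply: ae_imply aez => s H /andP[Ts _]; exact: H.
Unshelve. all: by end_near. Qed.

Lemma eventually_ge_of_drift n (z : R -> 'cV[R]_n) i (M k T : R) :
  0 <= T -> (forall b, 0 <= b -> absolutely_continuous 0 b z) -> 0 < k ->
  {ae mu, forall t, T <= t -> z t i 0 < M ->
     exists2 D, is_derive t (1 : R) z D & k <= D i 0} ->
  \forall t \near +oo, M <= z t i 0.
Proof.
move=> T0 acz k0 aez.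
have : \forall t \near +oo, (- z t) i 0 <= - M.
  apply: (@eventually_le_of_drift _ (fun t => - z t) i (- M) k T T0) => //.
    by move=> b b0; exact/absolutely_continuousN/acz.
  apply: ae_imply aez => t H Tt; rewrite mxE ltrN2 => /(H Tt)[D zD kD].
  by exists (- D); [exact: is_deriveN | rewrite mxE lerN2].
by apply: filterS => t; rewrite mxE lerN2.
Qed.

End Drift.

(** * Projection onto the tangent cone of a box *)

Section BoxProjection.
Context {R : realType}.

Lemma quadE n (v : 'cV[R]_n) : (v^T *m v) 0 0 = \sum_i v i 0 ^+ 2.
Proof. by rewrite mxE; apply: eq_bigr => i _; rewrite mxE expr2. Qed.

Lemma quad_ge0 n (v : 'cV[R]_n) : 0 <= (v^T *m v) 0 0.
Proof. by rewrite quadE; apply: sumr_ge0 => i _; exact: sqr_ge0. Qed.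

Lemma ler_enorm n (v w : 'cV[R]_n) :
  (enorm v <= enorm w) = ((v^T *m v) 0 0 <= (w^T *m w) 0 0).
Proof. by rewrite ler_sqrt ?quad_ge0. Qed.

Section Box.
Variables (m : nat) (umin umax u : 'cV[R]_m).
Hypothesis uU : box umin umax u.

(** The set whose closure is taken is already closed: a vector that points
    inwards at every active constraint stays feasible for a small step, because
    there are finitely many coordinates. *)
Lemma tangent_cone_box : tangent_cone (box umin umax) u =
  [set v | forall i, (u i 0 = umin i 0 -> 0 <= v i 0) /\
                     (u i 0 = umax i 0 -> v i 0 <= 0)].
Proof.
apply/seteqP; split => v.
  move=> clv i; split=> ui; rewrite leNgt; apply/negP => vi.
  - have /clv[_ /= [[d d0 [c /(_ i)/andP[cmin _] ->]]]] :
        \forall w \near v, (w : 'cV[R]_m) i 0 < 0.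
      exact: (cvgr_lt (v i 0) (@coord_continuous R m 1 i 0 v)).
    by rewrite !mxE pmulr_rlt0 ?invr_gt0// subr_lt0 ui ltNge cmin.
  - have /clv[_ /= [[d d0 [c /(_ i)/andP[_ cmax] ->]]]] :
        \forall w \near v, 0 < (w : 'cV[R]_m) i 0.
      exact: (cvgr_gt (v i 0) (@coord_continuous R m 1 i 0 v)).
    by rewrite !mxE pmulr_rgt0 ?invr_gt0// subr_gt0 ui ltNge cmax.
move=> vP; apply: subset_closure => /=.
suff [d d0 dU] : exists2 d, 0 < d & box umin umax (u + d *: v).
  exists d => //; exists (u + d *: v) => //.
  by rewrite addrC addKr scalerA mulVf ?gt_eqF// scale1r.
have dcvg i : u i 0 + d * v i 0 @[d --> (0 : R)] --> u i 0.
  rewrite -[X in _ --> X](addr0 (u i 0)) -[X in _ --> _ + X](mul0r (v i 0)).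
  by apply: cvgD; [exact: cvg_cst | apply: cvgM => //; exact: cvg_cst].
have : \forall d \near 0^'+, forall i, umin i 0 <= u i 0 + d * v i 0 <= umax i 0.
  apply: filter_forall => i; have [vmin vmax] := vP i; have /andP[umini umaxi] := uU i.
  have low : \forall d \near 0^'+, umin i 0 <= u i 0 + d * v i 0.
    have [ui|ui] := eqVneq (u i 0) (umin i 0).
      by near do rewrite ui lerDl mulr_ge0 ?vmin//.
    near do apply: ltW; apply: cvg_within; apply: (cvgr_gt (u i 0) (dcvg i)).
    by rewrite lt_neqAle eq_sym ui.
  have high : \forall d \near 0^'+, u i 0 + d * v i 0 <= umax i 0.
    have [ui|ui] := eqVneq (u i 0) (umax i 0).
      by near do rewrite ui gerDl mulr_ge0_le0 ?vmax//.
    near do apply: ltW; apply: cvg_within; apply: (cvgr_lt (u i 0) (dcvg i)).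
    by rewrite lt_neqAle ui.
  by near=> d; apply/andP; split; near: d.
move=> H; near (0 : R)^'+ => d; exists d => // i.
by rewrite !mxE; move: i; near: d.
Unshelve. all: by end_near. Qed.

(** The cone is a product of cones of the real line, so zeroing the coordinates
    that point outwards at an active bound gives a nearest point; existence is
    what makes the choice in [proj_tangent] meaningful. *)
Lemma proj_tangent_boxP v :
  is_euclidean_projection (tangent_cone (box umin umax) u) v
    (proj_tangent (box umin umax) u v).
Proof.
rewrite /proj_tangent; set P := [set w | _].
suff : exists w, P w by move=> [w Pw]; exact: (@xgetI _ 0 P w Pw).
pose w : 'cV[R]_m := \col_i
  if (u i 0 == umin i 0) && (v i 0 < 0) || (u i 0 == umax i 0) && (0 < v i 0)
  then 0 else v i 0.
exists w; split.
  rewrite tangent_cone_box => i; rewrite mxE.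
  split=> /eqP ->; case: ifP => //= /negbT; rewrite negb_or => /andP[h1 h2].
    by rewrite leNgt.
  by rewrite leNgt.
move=> z; rewrite tangent_cone_box => Kz; rewrite ler_enorm !quadE.
apply: ler_sum => i _; have [zmin zmax] := Kz i; rewrite !mxE.
case: ifP => [/orP[/andP[/eqP ui vi]|/andP[/eqP ui vi]]|_].
- have := zmin ui; rewrite subr0; nra.
- have := zmax ui; rewrite subr0; nra.
- by rewrite subrr expr0n sqr_ge0.
Qed.

(** Resetting one coordinate of the projection to that of [v] strictly reduces
    the distance to [v], unless the two already agree there. *)
Lemma projection_coord (K : set 'cV[R]_m) (v w : 'cV[R]_m) i :
  is_euclidean_projection K v w ->
  K (\col_j if j == i then v j 0 else w j 0) -> w i 0 = v i 0.
Proof.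
move=> [_ wmin] /wmin; rewrite ler_enorm !quadE (bigD1 i)//= [leRHS](bigD1 i)//=.
under [X in _ + X <= _]eq_bigr => j ji do rewrite !mxE.
under [X in _ <= _ + X]eq_bigr => j ji do rewrite !mxE (negbTE ji).
rewrite lerD2r !mxE eqxx subrr expr0n/= => h.
have : (v i 0 - w i 0) ^+ 2 == 0 by rewrite eq_le h sqr_ge0.
by rewrite sqrf_eq0 subr_eq0 => /eqP.
Qed.

(** When the lower bound is inactive, the projection alters the coordinate only
    at the upper bound, where it replaces a positive velocity by [0]. *)
Lemma proj_tangent_box_le (v : 'cV[R]_m) i : umin i 0 < u i 0 ->
  proj_tangent (box umin umax) u v i 0 <= v i 0.
Proof.
move=> ui; have := proj_tangent_boxP v; set w := proj_tangent _ _ _ => wP.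
rewrite leNgt; apply/negP => vw.
suff wv : w i 0 = v i 0 by rewrite wv ltxx in vw.
apply: (projection_coord wP); have := wP.1; rewrite tangent_cone_box => Kw j.
rewrite mxE; case: eqVneq => [->|_]; last exact: Kw.
split=> [uj|/(Kw i).2]; first by rewrite uj ltxx in ui.
by move=> /(lt_le_trans vw)/ltW.
Qed.

Lemma proj_tangent_box_ge (v : 'cV[R]_m) i : u i 0 < umax i 0 ->
  v i 0 <= proj_tangent (box umin umax) u v i 0.
Proof.
move=> ui; have := proj_tangent_boxP v; set w := proj_tangent _ _ _ => wP.
rewrite leNgt; apply/negP => wv.
suff vw : w i 0 = v i 0 by rewrite vw ltxx in wv.
apply: (projection_coord wP); have := wP.1; rewrite tangent_cone_box => Kw j.
rewrite mxE; case: eqVneq => [->|_]; last exact: Kw.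
split=> [/(Kw i).1|uj]; last by rewrite uj ltxx in ui.
by move=> /le_lt_trans/(_ wv)/ltW.
Qed.

End Box.

End BoxProjection.

(** * Quadratic costs and the small-gain inequality *)

Section QuadraticCost.
Context {R : realType}.

(** The difference quotient along the [j]-th axis is exactly
    [b * (2 * v j 0 + t)]. *)
Lemma grad_quad n (b : R) (h : 'cV[R]_n -> R) (v : 'cV[R]_n) :
  (forall w, h w = b * (w^T *m w) 0 0) -> grad h v = (2 * b) *: v.
Proof.
move=> hE; apply/matrixP => j k; rewrite !mxE ord1 /derive; apply/cvg_lim => //.
have E : \forall t \near 0^', b * (2 * v j 0 + t) =
    t^-1 *: ((h \o shift v) (t *: delta_mx j 0) - h v).
  near=> t.
  have t0 : t != 0 by near: t; exact: nbhs_dnbhs_neq.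
  rewrite /= !hE -mulrBr !quadE (bigD1 j)//= [X in _ - X](bigD1 j)//=.
  under eq_bigr => i ij do rewrite !mxE (negbTE ij) mulr0 add0r.
  rewrite !mxE !eqxx mulr1 [RHS]/GRing.scale/=; field; exact: t0.
apply: cvg_trans; first exact: near_eq_cvg E.
have -> : 2 * b * v j 0 = b * (2 * v j 0 + 0) by ring.
apply: cvgM; first exact: cvg_cst.
by apply: cvgD; [exact: cvg_cst | exact: nbhs_dnbhs].
Unshelve. all: by end_near. Qed.

Lemma jac_linear m p (S : 'M[R]_(p, m)) (h : 'cV[R]_m -> 'cV[R]_p) v :
  (forall w, h w = S *m w) -> jac h v = S.
Proof.
move=> hE; apply/matrixP => i j; rewrite mxE /derive.
have E : \forall t \near 0^', S *m delta_mx j 0 =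
    t^-1 *: ((h \o shift v) (t *: delta_mx j 0) - h v).
  near=> t.
  have t0 : t != 0 by near: t; exact: nbhs_dnbhs_neq.
  by rewrite /= !hE mulmxDr addrK -scalemxAr scalerA mulVf// scale1r.
have /cvg_lim -> // :
    t^-1 *: ((h \o shift v) (t *: delta_mx j 0) - h v) @[t --> 0^']
      --> S *m delta_mx j 0.
  by apply: cvg_trans; [exact: near_eq_cvg E | exact: cvg_cst].
by rewrite -colE mxE.
Unshelve. all: by end_near. Qed.

Lemma enorm_sqr n (v : 'cV[R]_n) : enorm v ^+ 2 = (v^T *m v) 0 0.
Proof. by rewrite sqr_sqrtr ?quad_ge0. Qed.

Lemma quad_eq0 n (v : 'cV[R]_n) : (v^T *m v) 0 0 = 0 -> v = 0.
Proof.
rewrite quadE => /eqP; rewrite psumr_eq0 => [/allP v0|i _]; last exact: sqr_ge0.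
apply/matrixP => i j; rewrite ord1 mxE; apply/eqP.
by have := v0 i (mem_index_enum i); rewrite sqrf_eq0.
Qed.

Lemma enorm0 n : enorm (0 : 'cV[R]_n) = 0.
Proof. by rewrite /enorm mulmx0 mxE sqrtr0. Qed.

Lemma enormZ n (a : R) (v : 'cV[R]_n) : enorm (a *: v) = `|a| * enorm v.
Proof.
rewrite /enorm !quadE; under eq_bigr do rewrite mxE exprMn.
rewrite -mulr_sumr; by rewrite sqrtrM ?sqr_ge0// sqrtr_sqr.
Qed.

(** The supremum defining the spectral norm is only an upper bound once the set
    is known to be bounded; the absolute row sums of [S] provide a crude
    bound. *)
Lemma enorm_mulmx_le p m (S : 'M[R]_(p, m)) (w : 'cV[R]_m) :
  enorm (S *m w) <= spectral_norm S * enorm w.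
Proof.
have [w0|w0] := eqVneq (enorm w) 0.
  have -> : w = 0 by apply: quad_eq0; rewrite -enorm_sqr w0 expr0n.
  by rewrite mulmx0 !enorm0 mulr0.
have wp : 0 < enorm w by rewrite lt_neqAle eq_sym w0 sqrtr_ge0.
rewrite -ler_pdivrMr//.
have -> : enorm (S *m w) / enorm w = enorm (S *m ((enorm w)^-1 *: w)).
  by rewrite -scalemxAr enormZ ger0_norm ?invr_ge0 ?sqrtr_ge0// mulrC.
apply: ub_le_sup; last first.
  by exists ((enorm w)^-1 *: w) => //=; rewrite enormZ ger0_norm ?invr_ge0 ?sqrtr_ge0//
    mulVf.
exists (Num.sqrt (\sum_i (\sum_j `|S i j|) ^+ 2)) => _ [v /= v1 <-].
rewrite ler_sqrt; last by apply: sumr_ge0 => i _; exact: sqr_ge0.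
rewrite quadE; apply: ler_sum => i _.
rewrite -[leLHS]real_normK ?num_real// ler_pXn2r ?nnegrE ?normr_ge0//; last first.
  exact: sumr_ge0.
rewrite mxE; apply: le_trans (ler_norm_sum _ _ _) _; apply: ler_sum => j _.
rewrite normrM ler_piMr ?normr_ge0//.
have vj : v j 0 ^+ 2 <= 1.
  apply: (@le_trans _ _ (enorm v ^+ 2)); last by rewrite expr_le1// sqrtr_ge0.
  rewrite enorm_sqr quadE (bigD1 j)//= lerDl; apply: sumr_ge0 => k _; exact: sqr_ge0.
by rewrite -(@ler_pXn2r _ 2) ?nnegrE ?normr_ge0// expr1n real_normK ?num_real.
Qed.

Lemma dot_mulmx m p (S : 'M[R]_(p, m)) (w : 'cV[R]_m) :
  \sum_i w i 0 * (S^T *m (S *m w)) i 0 = ((S *m w)^T *m (S *m w)) 0 0.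
Proof.
rewrite trmx_mul -mulmxA [RHS]mxE.
by apply: eq_bigr => i _; rewrite [X in _ = X * _]mxE.
Qed.

(** Pairing the hypothesis with the nonnegative vector [w] turns it into
    [beta_u |w|^2 <= beta_y |S w|^2]. *)
Lemma small_gain m p (S : 'M[R]_(p, m)) (beta_u beta_y : R) (w : 'cV[R]_m) :
  0 < beta_y -> beta_y * spectral_norm S ^+ 2 < beta_u -> (forall i, 0 <= w i 0) ->
  (forall i, beta_u * w i 0 <= beta_y * (S^T *m (S *m w)) i 0) -> w = 0.
Proof.
move=> bY0 gain w0 wle; apply: quad_eq0.
have h1 : beta_u * (w^T *m w) 0 0 <= beta_y * ((S *m w)^T *m (S *m w)) 0 0.
  rewrite -dot_mulmx quadE !mulr_sumr; apply: ler_sum => i _.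
  by rewrite expr2 mulrCA [leRHS]mulrCA; exact: ler_wpM2l.
have h2 : ((S *m w)^T *m (S *m w)) 0 0 <= spectral_norm S ^+ 2 * (w^T *m w) 0 0.
  rewrite -!enorm_sqr -exprMn.
  have := enorm_mulmx_le S w; have : 0 <= enorm (S *m w) by exact: sqrtr_ge0.
  by move=> h0 h; rewrite ler_pXn2r ?nnegrE// (le_trans h0).
have h3 := quad_ge0 w; apply/eqP; rewrite eq_le h3 andbT leNgt; apply/negP => h4.
have : beta_y * spectral_norm S ^+ 2 * (w^T *m w) 0 0 < beta_u * (w^T *m w) 0 0.
  by rewrite ltr_pM2r.
rewrite ltNge => /negP; apply; apply: le_trans h1 _.
by rewrite -mulrA ler_wpM2l// ltW.
Qed.

Lemma quadD n (a d : 'cV[R]_n) : ((a + d)^T *m (a + d)) 0 0 =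
  (a^T *m a) 0 0 + 2 * (\sum_i d i 0 * a i 0) + (d^T *m d) 0 0.
Proof.
rewrite !quadE mulr_sumr -!big_split/=; apply: eq_bigr => i _; rewrite !mxE; ring.
Qed.

(** The sign conditions say that the gradient at [ustar] makes a nonnegative
    product with every feasible direction; the quadratic remainder of the cost
    is nonnegative. *)
Lemma box_quad_minimizer m p (umin umax ustar : 'cV[R]_m) (S : 'M[R]_(p, m))
    (beta_u beta_y : R) (ky : 'cV[R]_m -> 'cV[R]_p) Phi_u Phi_y :
  (forall u, ky u = S *m u) -> 0 < beta_u -> 0 < beta_y ->
  (forall u, Phi_u u = beta_u * (u^T *m u) 0 0) ->
  (forall y, Phi_y y = beta_y * (y^T *m y) 0 0) ->
  box umin umax ustar ->
  (forall i, umin i 0 < ustar i 0 ->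
    beta_u * ustar i 0 + beta_y * (S^T *m (S *m ustar)) i 0 <= 0) ->
  (forall i, ustar i 0 < umax i 0 ->
    0 <= beta_u * ustar i 0 + beta_y * (S^T *m (S *m ustar)) i 0) ->
  is_minimizer Phi_u Phi_y (box umin umax) ky ustar (ky ustar).
Proof.
move=> kyE bu0 bY0 PuE PyE usU Gle Gge; split => // v _ vU ->.
have [d vE] : exists d, v = ustar + d by exists (v - ustar); rewrite addrC subrK.
rewrite !PuE !PyE !kyE [in leRHS]vE.
rewrite (mulmxDr S) !quadD.
have dG : 0 <= beta_u * (\sum_i d i 0 * ustar i 0) +
    beta_y * (\sum_i (S *m d) i 0 * (S *m ustar) i 0).
  have -> : \sum_i (S *m d) i 0 * (S *m ustar) i 0 =
      \sum_i d i 0 * (S^T *m (S *m ustar)) i 0.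
    transitivity (((S *m d)^T *m (S *m ustar)) 0 0).
      by rewrite [RHS]mxE; apply: eq_bigr => i _; rewrite [in RHS]mxE.
    rewrite trmx_mul -mulmxA [LHS]mxE.
    by apply: eq_bigr => i _; rewrite [X in X * _ = _]mxE.
  rewrite !mulr_sumr -big_split/=; apply: sumr_ge0 => i _.
  rewrite mulrCA [X in _ + X]mulrCA -mulrDr.
  have /andP[h1 h2] := vU i; have := Gle i; have := Gge i.
  have di : v i 0 = ustar i 0 + d i 0 by rewrite vE mxE.
  have [d0|d0|->] := ltgtP (d i 0) 0; last by rewrite mul0r.
  - have us1 : umin i 0 < ustar i 0 by lra.
    by move=> _ /(_ us1) h; rewrite mulr_le0// ltW.
  - have us1 : ustar i 0 < umax i 0 by lra.
    by move=> /(_ us1) h _; rewrite mulr_ge0// ltW.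
have h1 : 0 <= beta_u * (d^T *m d) 0 0 by rewrite mulr_ge0 ?quad_ge0// ltW.
have h2 : 0 <= beta_y * ((S *m d)^T *m (S *m d)) 0 0 by rewrite mulr_ge0 ?quad_ge0// ltW.
move: dG h1 h2; rewrite !mulrDr.
move: (\sum_i _) (\sum_i _) ((ustar^T *m ustar) 0 0) ((d^T *m d) 0 0) => s1 s2 q1 q2.
lra.
Qed.

End QuadraticCost.

(** * Asymptotic bounds *)

Section Asymptotics.
Context {R : realType}.

Lemma locally_lipschitz_continuous (V W : normedModType R) (h : V -> W) :
  locally_lipschitz h -> continuous h.
Proof.
move=> lh x; apply/cvgrPdist_lt => e e0.
have [M [M0 HM]] : exists M, 0 < M /\ M.-lipschitz_on h (nbhs (x, x)).
  have /= := lh x; move=> lx.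
  near (+oo : set_system R) => M; exists M; split; near: M => //.
  exact: nbhs_pinfty_gt.
have [[P Q] /= [Px Qx] PQ] :
    nbhs (x, x) [set yz | `|h yz.1 - h yz.2| <= M * `|yz.1 - yz.2|].
  exact: HM.
near=> y.
have Py : P x by exact: nbhs_singleton.
have Qy : Q y by near: y.
have /= := PQ (x, y) (conj Py Qy) => /le_lt_trans; apply.
rewrite -ltr_pdivlMl//; near: y.
apply: (@cvgr_dist_lt _ _ _ (nbhs x)); first exact: cvg_id.
by rewrite mulr_gt0 ?invr_gt0.
Unshelve. all: by end_near. Qed.

Lemma cvg_coord n (z : R -> 'cV[R]_n) (l : 'cV[R]_n) :
  (forall i e, 0 < e -> \forall t \near +oo, z t i 0 <= l i 0 + e) ->
  (forall i e, 0 < e -> \forall t \near +oo, l i 0 - e <= z t i 0) ->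
  z t @[t --> +oo] --> l.
Proof.
move=> Hle Hge; apply/cvgrPdist_le => e e0.
have Hl : \forall t \near +oo, forall i, z t i 0 <= l i 0 + e.
  by apply: filter_forall => i; exact: Hle.
have Hg : \forall t \near +oo, forall i, l i 0 - e <= z t i 0.
  by apply: filter_forall => i; exact: Hge.
near=> t; rewrite [leLHS]mx_normrE; apply: bigmax_le => [|[i j] _]; first exact: ltW.
rewrite /= ord1 !mxE ler_norml.
have h1 : z t i 0 <= l i 0 + e by move: i; near: t.
have h2 : l i 0 - e <= z t i 0 by move: i {h1}; near: t.
lra.
Unshelve. all: by end_near. Qed.

(** The superior limit of a bounded real function, as the infimum of its
    eventual upper bounds. *)
Lemma eventual_sup (z : R -> R) (lo hi : R) :
  (forall t, 0 <= t -> lo <= z t <= hi) ->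
  exists s, [/\ lo <= s <= hi, forall e, 0 < e -> \forall t \near +oo, z t <= s + e &
    forall M, (\forall t \near +oo, z t <= M) -> s <= M].
Proof.
move=> zb; pose A := [set M | \forall t \near +oo, z t <= M].
have Ahi : A hi.
  near=> t; have /zb/andP[] // : 0 <= t.
  by near: t; apply: nbhs_pinfty_ge; exact: num_real.
have lbA : lbound A lo.
  move=> M AM; near (+oo : set_system R) => t.
  have /zb/andP[h _] : 0 <= t by near: t; apply: nbhs_pinfty_ge; exact: num_real.
  by apply: le_trans h _; near: t.
have infA : has_inf A by split; [exists hi | exists lo].
exists (inf A); split.
- by apply/andP; split; [apply: lb_le_inf => //; exists hi | apply: ge_inf => //; case: infA].
- move=> e e0; have [M AM MA] := inf_adherent e0 infA.
  by apply: filterS AM => t /le_trans; apply; exact: ltW.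
- by move=> M AM; apply: ge_inf => //; case: infA.
Unshelve. all: by end_near. Qed.

Lemma eventual_inf (z : R -> R) (lo hi : R) :
  (forall t, 0 <= t -> lo <= z t <= hi) ->
  exists s, [/\ lo <= s <= hi, forall e, 0 < e -> \forall t \near +oo, s - e <= z t &
    forall M, (\forall t \near +oo, M <= z t) -> M <= s].
Proof.
move=> zb; have [|s [sb s1 s2]] := @eventual_sup (fun t => - z t) (- hi) (- lo).
  by move=> t /zb/andP[h1 h2]; rewrite !lerN2 h1 h2.
exists (- s); split.
- by rewrite lerNr lerNl andbC.
- by move=> e /s1; apply: filterS => t; rewrite lerNl opprD.
- by move=> M H; rewrite lerNr; apply: s2; apply: filterS H => t; rewrite lerN2.
Qed.

Lemma mulmx_eventually_ge k l (A : 'M[R]_(k, l)) (z : R -> 'cV[R]_l) (b : 'cV[R]_l) i :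
  (forall i j, 0 <= A i j) ->
  (forall j e, 0 < e -> \forall t \near +oo, b j 0 - e <= z t j 0) ->
  forall e, 0 < e -> \forall t \near +oo, (A *m b) i 0 - e <= (A *m z t) i 0.
Proof.
move=> A0 zb e e0; pose c := 1 + \sum_j A i j.
have c1 : 1 <= c by rewrite lerDl; apply: sumr_ge0.
have c0 : 0 < c by apply: lt_le_trans c1.
have ec : 0 < e / c by rewrite divr_gt0.
have : \forall t \near +oo, forall j, b j 0 - e / c <= z t j 0.
  by apply: filter_forall => j; exact: zb.
apply: filterS => t zt; rewrite !mxE.
have sA : (\sum_j A i j) * (e / c) <= e.
  by rewrite mulrCA ler_piMr ?(ltW e0)// ler_pdivrMr// mul1r lerDr.
apply: (@le_trans _ _ (\sum_j A i j * b j 0 - (\sum_j A i j) * (e / c))).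
  by rewrite lerB.
rewrite mulr_suml -sumrB; apply: ler_sum => j _; rewrite -mulrBr.
by apply: ler_wpM2l.
Qed.

Lemma mulmx_eventually_le k l (A : 'M[R]_(k, l)) (z : R -> 'cV[R]_l) (b : 'cV[R]_l) i :
  (forall i j, 0 <= A i j) ->
  (forall j e, 0 < e -> \forall t \near +oo, z t j 0 <= b j 0 + e) ->
  forall e, 0 < e -> \forall t \near +oo, (A *m z t) i 0 <= (A *m b) i 0 + e.
Proof.
move=> A0 zb e e0.
have : \forall t \near +oo, (A *m - b) i 0 - e <= (A *m - z t) i 0.
  apply: mulmx_eventually_ge => // j d d0; apply: filterS (zb j d d0) => t.
  by rewrite !mxE -opprD lerN2.
by apply: filterS => t; rewrite !mulmxN !mxE -opprD lerN2.
Qed.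

End Asymptotics.

(** * The plant under bounded inputs *)

Section Plant.
Context {R : realType}.

Lemma cst_admissible m (v : 'cV[R]_m) : admissible_input (cst v : R -> _).
Proof.
split=> [i|T]; first exact: measurable_cst.
by exists `|v|; split; [exact: num_real | move=> M vM t _; exact: ltW].
Qed.

Lemma box_normr_le m (umin umax u : 'cV[R]_m) : box umin umax u ->
  `|u| <= `|umin| + `|umax|.
Proof.
move=> uU; rewrite [leLHS]mx_normrE; apply: bigmax_le => [|[i j] _]; first exact: addr_ge0.
rewrite /= ord1; have /andP[h1 h2] := uU i.
have := coord_normr_le umin i; have := coord_normr_le umax i.
rewrite !ler_norml => /andP[_ h3] /andP[h4 _].
by apply/andP; split; [have := normr_ge0 umax | have := normr_ge0 umin]; lra.
Qed.

Lemma box_admissible m (umin umax : 'cV[R]_m) F (u : R -> 'cV[R]_m) :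
  (forall t, 0 <= t -> box umin umax (u t)) -> caratheodory_solution F u ->
  admissible_input u.
Proof.
move=> uU uF; split=> [i|T].
  apply: subspace_continuous_measurable_fun; first exact: measurable_itv.
  exact: caratheodory_continuous uF.
exists (`|umin| + `|umax|); split=> [|M uM t /=]; first exact: num_real.
rewrite in_itv/= => /andP[t0 _].
exact: le_trans (box_normr_le (uU t t0)) (ltW uM).
Qed.

Section Comparison.
Variables (n m p : nat) (f : 'cV[R]_n -> 'cV[R]_m -> 'cV[R]_n).
Variables (g : 'cV[R]_n -> 'cV[R]_p) (kx : 'cV[R]_m -> 'cV[R]_n).
Hypothesis plant : plant_assumption f g kx.
Hypothesis mono : monotone_system f g (nonneg_orthant (n := m))
  (nonneg_orthant (n := n)) (nonneg_orthant (n := p)).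

Lemma plant_solution_shift u x0 x (T : R) : 0 <= T -> plant_solution f u x0 x ->
  plant_solution f (fun t => u (t + T)) (x T) (fun t => x (t + T)).
Proof.
by move=> T0 [_ xf]; split; [rewrite add0r | exact: caratheodory_shift T0 xf].
Qed.

Lemma constant_input_output (v : 'cV[R]_m) x0 : exists X,
  plant_solution f (cst v) x0 X /\
  forall j, (g (X t)) j 0 @[t --> +oo] --> (g (kx v)) j 0.
Proof.
have [_ gl _ /(_ v x0)[[X XP] Xcvg] _] := plant; exists X; split => // j.
have /Xcvg Xv := XP.
apply: (@cvg_comp _ _ _ (g \o X) (fun w : 'cV[R]_p => w j 0) _ (nbhs (g (kx v)))).
  apply: (cvg_comp _ _ Xv); exact: (locally_lipschitz_continuous gl).
exact: coord_continuous.
Qed.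

Lemma cone_ge_nonnegP k (v w : 'cV[R]_k) :
  cone_ge (nonneg_orthant (n := k)) v w <-> forall i, w i 0 <= v i 0.
Proof. by split=> H i; have := H i; rewrite !mxE subr_ge0. Qed.

(** From time [T] on, the plant is dominated by the trajectory that starts at
    [x T] with the constant input [v], and that one converges. *)
Lemma output_le_steady_state (u : R -> 'cV[R]_m) x0 x (v : 'cV[R]_m) (T e : R) j :
  0 <= T -> admissible_input (fun t => u (t + T)) ->
  (forall t, T <= t -> forall i, u t i 0 <= v i 0) ->
  plant_solution f u x0 x -> 0 < e ->
  \forall t \near +oo, g (x t) j 0 <= g (kx v) j 0 + e.
Proof.
move=> T0 uadm uv xP e0; have [_ Mx Mg] := mono.
have [X [XP Xcvg]] := constant_input_output v (x T).
have le_xX t : 0 <= t -> g (x (t + T)) j 0 <= g (X t) j 0.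
  move=> t0; move: j {Xcvg}; apply/cone_ge_nonnegP/Mg.
  apply: (Mx _ _ _ _ _ _ (cst_admissible v) uadm _ _ XP
    (plant_solution_shift T0 xP)) => //.
    by apply: aeW => s s0; apply/cone_ge_nonnegP; apply: uv; rewrite lerDr.
  by apply/cone_ge_nonnegP.
have [A [_ HA]] := cvgr_le _ (Xcvg j) (g (kx v) j 0 + e) ltac:(by rewrite ltrDl).
near=> t.
have tT : 0 <= t - T.
  by rewrite subr_ge0; near: t; apply: nbhs_pinfty_ge; exact: num_real.
have -> : x t = x (t - T + T) by rewrite subrK.
apply: le_trans (le_xX _ tT) _; apply: HA.
by rewrite ltrBrDr; near: t; apply: nbhs_pinfty_gt; exact: num_real.
Unshelve. all: by end_near. Qed.

Lemma output_ge_steady_state (u : R -> 'cV[R]_m) x0 x (v : 'cV[R]_m) (T e : R) j :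
  0 <= T -> admissible_input (fun t => u (t + T)) ->
  (forall t, T <= t -> forall i, v i 0 <= u t i 0) ->
  plant_solution f u x0 x -> 0 < e ->
  \forall t \near +oo, g (kx v) j 0 - e <= g (x t) j 0.
Proof.
move=> T0 uadm vu xP e0; have [_ Mx Mg] := mono.
have [X [XP Xcvg]] := constant_input_output v (x T).
have le_Xx t : 0 <= t -> g (X t) j 0 <= g (x (t + T)) j 0.
  move=> t0; move: j {Xcvg}; apply/cone_ge_nonnegP/Mg.
  apply: (Mx _ _ _ _ _ _ uadm (cst_admissible v) _ _
    (plant_solution_shift T0 xP) XP) => //.
    by apply: aeW => s s0; apply/cone_ge_nonnegP; apply: vu; rewrite lerDr.
  by apply/cone_ge_nonnegP.
have [A [_ HA]] := cvgr_ge _ (Xcvg j) (g (kx v) j 0 - e) ltac:(by rewrite gtrBl).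
near=> t.
have tT : 0 <= t - T.
  by rewrite subr_ge0; near: t; apply: nbhs_pinfty_ge; exact: num_real.
have -> : x t = x (t - T + T) by rewrite subrK.
apply: le_trans (le_Xx _ tT); apply: HA.
by rewrite ltrBrDr; near: t; apply: nbhs_pinfty_gt; exact: num_real.
Unshelve. all: by end_near. Qed.

(** The output under the input [0] tends to [0] and is asymptotically below
    that of the unit input [delta_mx j 0 >= 0], which is the [j]-th column of
    [S]. *)
Lemma steady_state_ge0 (S : 'M[R]_(p, m)) :
  (forall u, (g \o kx) u = S *m u) -> forall i j, 0 <= S i j.
Proof.
move=> kyE i j.
have [x [xP _]] := constant_input_output 0 0.
apply/ler_addgt0Pr => e e0.
have e20 : 0 < e / 2 by rewrite divr_gt0.
have T0 : (0 : R) <= 0 by [].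
have h1 := @output_le_steady_state _ _ _ (delta_mx j 0) 0 (e / 2) i T0
  (cst_admissible 0) _ xP e20.
have h2 := @output_ge_steady_state _ _ _ 0 0 (e / 2) i T0
  (cst_admissible 0) _ xP e20.
have [t] : exists t, g (x t) i 0 <= g (kx (delta_mx j 0)) i 0 + e / 2 /\
                    g (kx 0) i 0 - e / 2 <= g (x t) i 0.
  near (+oo : set_system R) => t; exists t; split; near: t.
    by apply: h1 => t _ k; rewrite !mxE; case: (_ && _).
  by apply: h2 => t _ k.
move: (kyE 0) (kyE (delta_mx j 0)) => /= -> ->.
by rewrite mulmx0 -colE !mxE; lra.
Unshelve. all: by end_near. Qed.

End Comparison.

Section SteadyOutput.
Variables (n m p : nat) (f : 'cV[R]_n -> 'cV[R]_m -> 'cV[R]_n).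
Variables (g : 'cV[R]_n -> 'cV[R]_p) (kx : 'cV[R]_m -> 'cV[R]_n).
Variable (S : 'M[R]_(p, m)).
Hypothesis plant : plant_assumption f g kx.
Hypothesis mono : monotone_system f g (nonneg_orthant (n := m))
  (nonneg_orthant (n := n)) (nonneg_orthant (n := p)).
Hypothesis kyE : forall u, (g \o kx) u = S *m u.
Variables (u : R -> 'cV[R]_m) (x0 : 'cV[R]_n) (x : R -> 'cV[R]_n).
Hypothesis uadm : forall T, 0 <= T -> admissible_input (fun t => u (t + T)).
Hypothesis xP : plant_solution f u x0 x.

Lemma mulmx_const_le (e : R) j : 0 < e ->
  exists2 d, 0 < d & (S *m const_mx d : 'cV[R]_p) j 0 <= e.
Proof.
move=> e0; have S0 := steady_state_ge0 plant mono kyE.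
have s0 : 0 <= \sum_k S j k by apply: sumr_ge0.
have c0 : 0 < 1 + \sum_k S j k by rewrite ltr_pwDl.
exists (e / (1 + \sum_k S j k)); first by rewrite divr_gt0.
rewrite mxE; under eq_bigr do rewrite mxE.
by rewrite -mulr_suml mulrCA ler_piMr ?(ltW e0)// ler_pdivrMr// mul1r lerDr.
Qed.

(** The constant input [w - d] bounds the input from below from some time on,
    and its steady-state output [S (w - d)] is close to [S w]. *)
Lemma output_eventually_ge (w : 'cV[R]_m) :
  (forall i e, 0 < e -> \forall t \near +oo, w i 0 - e <= u t i 0) ->
  forall j e, 0 < e -> \forall t \near +oo, (S *m w) j 0 - e <= g (x t) j 0.
Proof.
move=> uw j e e0; have e20 : 0 < e / 2 by rewrite divr_gt0.
have [d d0 Sd] := mulmx_const_le j e20.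
have [A [_ HA]] : \forall t \near +oo, forall i, w i 0 - d <= u t i 0.
  by apply: filter_forall => i; exact: uw.
have T0 : 0 <= Num.max 0 (A + 1) by rewrite le_max lexx.
have uT t : Num.max 0 (A + 1) <= t -> forall i, (w - const_mx d) i 0 <= u t i 0.
  move=> At i; rewrite !mxE; apply: HA; apply: lt_le_trans At.
  by rewrite lt_max ltrDl ltr01 orbT.
apply: filterS (output_ge_steady_state plant mono j T0 (uadm T0) uT xP e20) => t.
apply: le_trans; move: (kyE (w - const_mx d)) => /= ->.
have -> : (S *m (w - const_mx d)) j 0 = (S *m w) j 0 - (S *m const_mx d : 'cV_p) j 0.
  by rewrite mulmxBr mxE [X in _ + X]mxE.
lra.
Qed.

Lemma output_eventually_le (w : 'cV[R]_m) :
  (forall i e, 0 < e -> \forall t \near +oo, u t i 0 <= w i 0 + e) ->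
  forall j e, 0 < e -> \forall t \near +oo, g (x t) j 0 <= (S *m w) j 0 + e.
Proof.
move=> uw j e e0; have e20 : 0 < e / 2 by rewrite divr_gt0.
have [d d0 Sd] := mulmx_const_le j e20.
have [A [_ HA]] : \forall t \near +oo, forall i, u t i 0 <= w i 0 + d.
  by apply: filter_forall => i; exact: uw.
have T0 : 0 <= Num.max 0 (A + 1) by rewrite le_max lexx.
have uT t : Num.max 0 (A + 1) <= t -> forall i, u t i 0 <= (w + const_mx d) i 0.
  move=> At i; rewrite !mxE; apply: HA; apply: lt_le_trans At.
  by rewrite lt_max ltrDl ltr01 orbT.
apply: filterS (output_le_steady_state plant mono j T0 (uadm T0) uT xP e20) => t.
move=> /le_trans; apply; move: (kyE (w + const_mx d)) => /= ->.
have -> : (S *m (w + const_mx d)) j 0 = (S *m w) j 0 + (S *m const_mx d : 'cV_p) j 0.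
  by rewrite mulmxDr mxE.
lra.
Qed.

End SteadyOutput.

End Plant.

(** * The projected controller *)

Section ProjectedController.
Context {R : realType}.

Section Controller.
Variables (m : nat) (umin umax : 'cV[R]_m) (beta_u beta_y alpha : R).
Hypotheses (bu0 : 0 < beta_u) (bY0 : 0 < beta_y) (al0 : 0 < alpha).
Variables (u q : R -> 'cV[R]_m).
Hypothesis uU : forall t, 0 <= t -> box umin umax (u t).
Hypothesis uF : caratheodory_solution (fun t v =>
  proj_tangent (box umin umax) v (- (2 * alpha) *: (beta_u *: v + beta_y *: q t))) u.

(** While [M < u i], the lower bound is inactive and the [i]-th drift is at
    most [- alpha * (beta_u * M + beta_y * G)] once [q i] exceeds [G] minus
    half of the available margin. *)
Lemma controller_eventually_le i (G M : R) :
  (forall e, 0 < e -> \forall t \near +oo, G - e <= q t i 0) ->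
  umin i 0 < M -> 0 < beta_u * M + beta_y * G -> \forall t \near +oo, u t i 0 <= M.
Proof.
move=> qG Mmin MG; set k := beta_u * M + beta_y * G in MG.
(* a deviation of [q i] by [k / (2 * beta_y)] uses up half of the margin [k] *)
have e0 : 0 < k / (2 * beta_y) by rewrite divr_gt0// mulr_gt0.
have [A [_ HA]] := qG _ e0.
have [uAC uD] := uF.
have T0 : 0 <= Num.max 0 (A + 1) by rewrite le_max lexx.
have k0 : 0 < alpha * k by rewrite mulr_gt0.
apply: (eventually_le_of_drift T0 uAC k0); apply: ae_imply uD => t D Tt Mu.
have t0 : 0 <= t by apply: le_trans Tt.
eexists; first exact: D.
apply: le_trans (proj_tangent_box_le (uU t0) _ (lt_trans Mmin Mu)) _.
have qt : G - k / (2 * beta_y) <= q t i 0.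
  by apply: HA; apply: lt_le_trans Tt; rewrite lt_max ltrDl ltr01 orbT.
have h1 : beta_y * (G - k / (2 * beta_y)) <= beta_y * q t i 0 by rewrite ler_pM2l.
have h2 : beta_y * (k / (2 * beta_y)) = k / 2 by field; rewrite gt_eqF.
have h3 : beta_u * M <= beta_u * u t i 0 by rewrite ler_pM2l// ltW.
have h4 : k <= 2 * (beta_u * u t i 0 + beta_y * q t i 0).
  by rewrite mulrBr h2 in h1; move: h1 h3; rewrite /k; lra.
have h5 : alpha * k <= alpha * (2 * (beta_u * u t i 0 + beta_y * q t i 0)).
  by rewrite ler_pM2l.
by rewrite !mxE; lra.
Qed.

Lemma controller_eventually_ge i (G M : R) :
  (forall e, 0 < e -> \forall t \near +oo, q t i 0 <= G + e) ->
  M < umax i 0 -> beta_u * M + beta_y * G < 0 -> \forall t \near +oo, M <= u t i 0.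
Proof.
move=> qG Mmax MG; set k := beta_u * M + beta_y * G in MG.
have e0 : 0 < - k / (2 * beta_y) by rewrite divr_gt0 ?oppr_gt0// mulr_gt0.
have [A [_ HA]] := qG _ e0.
have [uAC uD] := uF.
have T0 : 0 <= Num.max 0 (A + 1) by rewrite le_max lexx.
have k0 : 0 < alpha * - k by rewrite mulr_gt0 ?oppr_gt0.
apply: (eventually_ge_of_drift T0 uAC k0); apply: ae_imply uD => t D Tt Mu.
have t0 : 0 <= t by apply: le_trans Tt.
eexists; first exact: D.
apply: le_trans _ (proj_tangent_box_ge (uU t0) _ (lt_trans Mu Mmax)).
have qt : q t i 0 <= G + - k / (2 * beta_y).
  by apply: HA; apply: lt_le_trans Tt; rewrite lt_max ltrDl ltr01 orbT.
have h1 : beta_y * q t i 0 <= beta_y * (G + - k / (2 * beta_y)) by rewrite ler_pM2l.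
have h2 : beta_y * (- k / (2 * beta_y)) = - k / 2 by field; rewrite gt_eqF.
have h3 : beta_u * u t i 0 <= beta_u * M by rewrite ler_pM2l// ltW.
have h4 : 2 * (beta_u * u t i 0 + beta_y * q t i 0) <= k.
  by rewrite mulrDr h2 in h1; move: h1 h3; rewrite /k; lra.
have h5 : alpha * (2 * (beta_u * u t i 0 + beta_y * q t i 0)) <= alpha * k.
  by rewrite ler_pM2l.
by rewrite !mxE; lra.
Qed.

End Controller.

End ProjectedController.

(** * Convergence of the closed loop *)

Theorem corollary1 (R : realType) (n m p : nat)
  (f : 'cV[R]_n -> 'cV[R]_m -> 'cV[R]_n) (g : 'cV[R]_n -> 'cV[R]_p)
  (kx : 'cV[R]_m -> 'cV[R]_n)
  (Phi : 'cV[R]_m -> 'cV[R]_p -> R)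
  (Phi_u : 'cV[R]_m -> R) (Phi_y : 'cV[R]_p -> R)
  (umin umax : 'cV[R]_m) (S : 'M[R]_(p, m)) (beta_u beta_y : R) :
  plant_assumption f g kx ->
  cost_assumption Phi Phi_u Phi_y ->
  monotone_system f g (nonneg_orthant (n := m)) (nonneg_orthant (n := n))
    (nonneg_orthant (n := p)) ->
  (forall u, (g \o kx) u = S *m u) ->
  0 < beta_u -> 0 < beta_y ->
  (forall u, Phi_u u = beta_u * (u^T *m u) 0 0) ->
  (forall y, Phi_y y = beta_y * (y^T *m y) 0 0) ->
  beta_y * spectral_norm S ^+ 2 < beta_u ->
  forall (alpha : R) (x0 : 'cV[R]_n) (u0 : 'cV[R]_m)
         (x : R -> 'cV[R]_n) (u : R -> 'cV[R]_m),
    0 < alpha ->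
    box umin umax u0 ->
    closed_loop_solution f g (g \o kx) Phi_u Phi_y (box umin umax) alpha
      x0 u0 x u ->
    exists (ustar : 'cV[R]_m) (ystar : 'cV[R]_p),
      [/\ is_minimizer Phi_u Phi_y (box umin umax) (g \o kx) ustar ystar,
          u t @[t --> +oo] --> ustar &
          g (x t) @[t --> +oo] --> ystar].
Proof.
move=> plant _ mono kyE bu0 bY0 PuE PyE gain alpha x0 u0 x u al0 _ [xP _ uU uF].
pose q t := S^T *m g (x t).
have uF' : caratheodory_solution (fun t v =>
    proj_tangent (box umin umax) v (- (2 * alpha) *: (beta_u *: v + beta_y *: q t))) u.
  move: uF; congr (caratheodory_solution _ _); apply/funext => t; apply/funext => v.
  congr (proj_tangent _ _ _).
  rewrite (grad_quad _ PuE) (grad_quad _ PyE) (jac_linear _ kyE) /q -scalemxAr.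
  by apply/matrixP => i j; rewrite !mxE; ring.
have uadm (T : R) : 0 <= T -> admissible_input (fun t => u (t + T)).
  move=> T0; apply: box_admissible (caratheodory_shift T0 uF) => t t0.
  by apply: uU; rewrite addr_ge0.
have S0 := steady_state_ge0 plant mono kyE.
have ST0 i j : 0 <= S^T i j by rewrite mxE.
have uUi i t : 0 <= t -> umin i 0 <= u t i 0 <= umax i 0 by move=> /uU.
have /choice[hi hiP] : forall i, exists s, [/\ umin i 0 <= s <= umax i 0,
    forall e, 0 < e -> \forall t \near +oo, u t i 0 <= s + e &
    forall M, (\forall t \near +oo, u t i 0 <= M) -> s <= M].
  by move=> i; exact: eventual_sup (uUi i).
have /choice[lo loP] : forall i, exists s, [/\ umin i 0 <= s <= umax i 0,
    forall e, 0 < e -> \forall t \near +oo, s - e <= u t i 0 &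
    forall M, (\forall t \near +oo, M <= u t i 0) -> M <= s].
  by move=> i; exact: eventual_inf (uUi i).
pose whi : 'cV[R]_m := \col_i hi i; pose wlo : 'cV[R]_m := \col_i lo i.
have uhi i e : 0 < e -> \forall t \near +oo, u t i 0 <= whi i 0 + e.
  by rewrite mxE; have [_ + _] := hiP i; apply.
have ulo i e : 0 < e -> \forall t \near +oo, wlo i 0 - e <= u t i 0.
  by rewrite mxE; have [_ + _] := loP i; apply.
have yhi := output_eventually_le plant mono kyE uadm xP uhi.
have ylo := output_eventually_ge plant mono kyE uadm xP ulo.
have qhi i := mulmx_eventually_le i ST0 yhi.
have qlo i := mulmx_eventually_ge i ST0 ylo.
have hi_lo i : lo i <= hi i.
  apply/ler_addgt0Pr => e e0; have e20 : 0 < e / 2 by rewrite divr_gt0.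
  have [t [h1 h2]] : exists t, u t i 0 <= hi i + e / 2 /\ lo i - e / 2 <= u t i 0.
    near (+oo : set_system R) => t; exists t; split; near: t.
      by have := uhi i _ e20; rewrite mxE.
    by have := ulo i _ e20; rewrite mxE.
  lra.
have hiG i : umin i 0 < hi i ->
    beta_u * hi i + beta_y * (S^T *m (S *m wlo)) i 0 <= 0.
  move=> hmin; rewrite leNgt; apply/negP; set G := (S^T *m _) i 0 => hG.
  have [M [Mmin MG Mhi]] : exists M,
      [/\ umin i 0 < M, 0 < beta_u * M + beta_y * G & M < hi i].
    (* close enough to [hi i] for half of the violation [k] to remain *)
    pose k := beta_u * hi i + beta_y * G.
    exists (Num.max ((umin i 0 + hi i) / 2) (hi i - k / (2 * beta_u))); split.
    - by rewrite lt_max; apply/orP; left; lra.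
    - have : beta_u * (hi i - k / (2 * beta_u)) <= beta_u *
          Num.max ((umin i 0 + hi i) / 2) (hi i - k / (2 * beta_u)).
        by rewrite ler_pM2l// le_max lexx orbT.
      have -> : beta_u * (hi i - k / (2 * beta_u)) = beta_u * hi i - k / 2.
        by field; rewrite gt_eqF.
      by move: hG; rewrite -/k /k; lra.
    - rewrite gt_max; apply/andP; split; first by lra.
      by rewrite gtrBl divr_gt0// mulr_gt0.
  have [_ _ /(_ M)] := hiP i; rewrite leNgt Mhi => H.
  have /H// := controller_eventually_le bu0 bY0 al0 uU uF' (qlo i) Mmin MG.
have loG i : lo i < umax i 0 ->
    0 <= beta_u * lo i + beta_y * (S^T *m (S *m whi)) i 0.
  move=> hmax; rewrite leNgt; apply/negP; set G := (S^T *m _) i 0 => hG.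
  have [M [Mmax MG Mlo]] : exists M,
      [/\ M < umax i 0, beta_u * M + beta_y * G < 0 & lo i < M].
    pose k := beta_u * lo i + beta_y * G.
    exists (Num.min ((umax i 0 + lo i) / 2) (lo i - k / (2 * beta_u))); split.
    - by rewrite gt_min; apply/orP; left; lra.
    - have : beta_u * Num.min ((umax i 0 + lo i) / 2) (lo i - k / (2 * beta_u)) <=
          beta_u * (lo i - k / (2 * beta_u)).
        by rewrite ler_pM2l// ge_min lexx orbT.
      have -> : beta_u * (lo i - k / (2 * beta_u)) = beta_u * lo i - k / 2.
        by field; rewrite gt_eqF.
      by move: hG; rewrite -/k /k; lra.
    - rewrite lt_min; apply/andP; split; first by lra.
      by rewrite ltrDl oppr_gt0 pmulr_llt0 ?invr_gt0 ?mulr_gt0.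
  have [_ _ /(_ M)] := loP i; rewrite leNgt Mlo => H.
  have /H// := controller_eventually_ge bu0 bY0 al0 uU uF' (qhi i) Mmax MG.
have whi_lo : whi = wlo.
  apply/eqP; rewrite -subr_eq0; apply/eqP; apply: (small_gain bY0 gain).
    by move=> i; rewrite !mxE subr_ge0.
  move=> i; rewrite !mulmxBr.
  have -> : (whi - wlo) i 0 = hi i - lo i by rewrite !mxE.
  have -> : (S^T *m (S *m whi) - S^T *m (S *m wlo)) i 0 =
      (S^T *m (S *m whi)) i 0 - (S^T *m (S *m wlo)) i 0.
    by rewrite mxE [X in _ + X]mxE.
  have dge0 : 0 <= beta_y * ((S^T *m (S *m whi)) i 0 - (S^T *m (S *m wlo)) i 0).
    rewrite mulr_ge0 ?(ltW bY0)// subr_ge0 [leLHS]mxE [leRHS]mxE.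
    apply: ler_sum => j _; apply: ler_wpM2l => //; rewrite [leLHS]mxE [leRHS]mxE.
    by apply: ler_sum => k _; apply: ler_wpM2l => //; rewrite !mxE.
  have [[/andP[hmin hmax] _ _] [/andP[lmin lmax] _ _]] := (hiP i, loP i).
  (* an inactive sign condition forces [hi i] and [lo i] to the same bound *)
  have [h1|h1] := leP (hi i) (umin i 0).
    have -> : hi i = lo i by apply/eqP; rewrite eq_le hi_lo (le_trans h1 lmin).
    by rewrite subrr mulr0.
  have [h2|h2] := leP (umax i 0) (lo i).
    have -> : hi i = lo i by apply/eqP; rewrite eq_le hi_lo (le_trans hmax h2).
    by rewrite subrr mulr0.
  by have := hiG i h1; have := loG i h2; lra.
exists whi, ((g \o kx) whi); split.
- apply: (box_quad_minimizer kyE bu0 bY0 PuE PyE).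
  + by move=> i; rewrite mxE; have [] := hiP i.
  + move=> i; have -> : whi i 0 = hi i by rewrite mxE.
    by rewrite whi_lo; exact: hiG.
  + move=> i; have -> : whi i 0 = lo i by rewrite whi_lo mxE.
    exact: loG.
- by apply: cvg_coord uhi _; rewrite whi_lo.
- by rewrite kyE; apply: cvg_coord yhi _; rewrite whi_lo.
Unshelve. all: by end_near. Qed.
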